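(* Let $K$ be a group and let $H$ be a normal subgroup of $K$. If $H$ and $G=K/H$ are both residually finite, then $K$ is weakly sofic.
   Context: A group $K$ is weakly sofic (i.e. metrically approximable by finite groups with bi-invariant metrics) if there is $\alpha>0$ such that for every finite subset $\Phi\subseteq K$ and every $\varepsilon>0$ there exist a finite group $Q$ equipped with a bi-invariant metric $d$ (i.e. $d(xz,yz)=d(zx,zy)=d(x,y)$ for all $x,y,z\in Q$) of diameter at most $1$, and a map $\varphi:\Phi\to Q$ with $\varphi(1)=1$ (if $1\in\Phi$), such that $d(\varphi(gh),\varphi(g)\varphi(h))<\varepsilon$ whenever $g,h,gh\in\Phi$, and $d(\varphi(g),1)>\alpha$ for every $g\in\Phi\setminus\{1\}$. *)

(* Defs.v *)
From Stdlib Require Import Reals List ProofIrrelevance.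
Set Implicit Arguments.
Open Scope R_scope.

Record Group := {
  carrier :> Type;
  gmul : carrier -> carrier -> carrier;
  ginv : carrier -> carrier;
  gone : carrier;
  gmul_assoc : forall x y z, gmul x (gmul y z) = gmul (gmul x y) z;
  gmul_1l : forall x, gmul gone x = x;
  gmul_1r : forall x, gmul x gone = x;
  gmul_Vl : forall x, gmul (ginv x) x = gone;
  gmul_Vr : forall x, gmul x (ginv x) = gone
}.

Arguments gmul {g} _ _.
Arguments ginv {g} _.
Arguments gone {g}.

Definition finite_group (Q : Group) : Prop :=
  exists l : list Q, forall x : Q, In x l.

Definition is_hom {G1 G2 : Group} (f : G1 -> G2) : Prop :=
  forall x y : G1, f (gmul x y) = gmul (f x) (f y).

Definition residually_finite (G : Group) : Prop :=
  forall g : G, g <> gone ->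
    exists (F : Group) (f : G -> F), finite_group F /\ is_hom f /\ f g <> gone.

Record normal_subgroup {K : Group} (H : K -> Prop) : Prop := {
  ns_one : H gone;
  ns_mul : forall {x y}, H x -> H y -> H (gmul x y);
  ns_inv : forall {x}, H x -> H (ginv x);
  ns_conj : forall g x, H x -> H (gmul (gmul g x) (ginv g))
}.

Section Sub.
Variables (K : Group) (H : K -> Prop) (hH : normal_subgroup H).

Definition sub_carrier := { x : K | H x }.
Definition sub_mul (a b : sub_carrier) : sub_carrier :=
  exist _ (gmul (proj1_sig a) (proj1_sig b)) (ns_mul hH (proj2_sig a) (proj2_sig b)).
Definition sub_inv (a : sub_carrier) : sub_carrier :=
  exist _ (ginv (proj1_sig a)) (ns_inv hH (proj2_sig a)).
Definition sub_one : sub_carrier := exist _ gone (ns_one hH).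

Lemma sub_eq (a b : sub_carrier) : proj1_sig a = proj1_sig b -> a = b.
Proof.
  destruct a as [a pa], b as [b pb]; simpl; intros ->.
  f_equal; apply proof_irrelevance.
Qed.

Lemma sub_assoc a b c : sub_mul a (sub_mul b c) = sub_mul (sub_mul a b) c.
Proof. apply sub_eq; simpl; apply gmul_assoc. Qed.
Lemma sub_1l a : sub_mul sub_one a = a.
Proof. apply sub_eq; simpl; apply gmul_1l. Qed.
Lemma sub_1r a : sub_mul a sub_one = a.
Proof. apply sub_eq; simpl; apply gmul_1r. Qed.
Lemma sub_Vl a : sub_mul (sub_inv a) a = sub_one.
Proof. apply sub_eq; simpl; apply gmul_Vl. Qed.
Lemma sub_Vr a : sub_mul a (sub_inv a) = sub_one.
Proof. apply sub_eq; simpl; apply gmul_Vr. Qed.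

Definition subgroup_group : Group :=
  @Build_Group sub_carrier sub_mul sub_inv sub_one sub_assoc sub_1l sub_1r sub_Vl sub_Vr.
End Sub.

Definition is_quotient_map {K : Group} (H : K -> Prop) {G : Group} (pi : K -> G) : Prop :=
  is_hom pi /\ (forall y : G, exists x : K, pi x = y) /\ (forall x : K, pi x = gone <-> H x).

Definition biinv_metric_diam1 {Q : Group} (d : Q -> Q -> R) : Prop :=
  (forall x y, 0 <= d x y) /\
  (forall x y, d x y = 0 <-> x = y) /\
  (forall x y, d x y = d y x) /\
  (forall x y z, d x z <= d x y + d y z) /\
  (forall x y z, d (gmul x z) (gmul y z) = d x y /\ d (gmul z x) (gmul z y) = d x y) /\
  (forall x y, d x y <= 1).

Definition weakly_sofic (K : Group) : Prop :=
  exists alpha : R, 0 < alpha /\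
  forall (Phi : list K) (eps : R), 0 < eps ->
    exists (Q : Group) (d : Q -> Q -> R) (phi : K -> Q),
      finite_group Q /\ biinv_metric_diam1 d /\
      (In gone Phi -> phi gone = gone) /\
      (forall g h, In g Phi -> In h Phi -> In (gmul g h) Phi ->
         d (phi (gmul g h)) (gmul (phi g) (phi h)) < eps) /\
      (forall g, In g Phi -> g <> gone -> alpha < d (phi g) gone).

(* Main.v *)
Require Import Defs.
From Stdlib Require Import Reals List.
From Stdlib Require Import Lia Lra ClassicalEpsilon FunctionalExtensionality ProofIrrelevance.

(** Let [kappa : K -> G -> H] be the Kaloujnine-Krasner cocycle of a section of
    [K -> G], and compose it with a finite quotient [H -> A].  Let [V] be a finite
    quotient of [G] that is injective on a large ball of [G].  For each radius
    [t < N] truncate the cocycle: on [V] use its values at the points coming from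
    the ball of radius [t], and the value [1] elsewhere.  This gives a map from [K]
    to the finite wreath product [(A^N)^V x| V].  Use on it the metric which, on
    pairs with the same [V]-part, is the maximum over [V] of the normalised Hamming
    distance on [A^N], and which is [1] otherwise.  At a given vertex [v] and for
    given [g], multiplicativity fails only for the radii [t] such that exactly one
    of [v], [v g] lies in the ball of radius [t]; there is at most one such radius,
    so the defect is at most [1/N].  A nontrivial element of [H] is seen at the
    vertex [1] for every radius, so it stays at distance [1] from the identity. *)

(** * Cancellation in groups and basic facts on homomorphisms *)

Lemma gmul_cancel_l (G : Group) (z x y : G) : gmul z x = gmul z y -> x = y.
Proof.
  intros E. apply (f_equal (gmul (ginv z))) in E.
  now rewrite !gmul_assoc, !gmul_Vl, !gmul_1l in E.
Qed.

Lemma gmul_cancel_r (G : Group) (z x y : G) : gmul x z = gmul y z -> x = y.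
Proof.
  intros E. apply (f_equal (fun w => gmul w (ginv z))) in E.
  now rewrite <- !gmul_assoc, !gmul_Vr, !gmul_1r in E.
Qed.

Lemma gmulK (G : Group) (x y : G) : gmul (gmul x y) (ginv y) = x.
Proof. now rewrite <- gmul_assoc, gmul_Vr, gmul_1r. Qed.

Lemma gmulVK (G : Group) (x y : G) : gmul (gmul x (ginv y)) y = x.
Proof. now rewrite <- gmul_assoc, gmul_Vl, gmul_1r. Qed.

Lemma hom_one {G F : Group} {f : G -> F} : is_hom f -> f gone = gone.
Proof.
  intros hf. apply (gmul_cancel_l _ (f gone)).
  now rewrite <- hf, gmul_1l, gmul_1r.
Qed.

Lemma hom_inv {G F : Group} {f : G -> F} (x : G) :
  is_hom f -> f (ginv x) = ginv (f x).
Proof.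
  intros hf. apply (gmul_cancel_r _ (f x)).
  now rewrite <- hf, !gmul_Vl, hom_one.
Qed.

(** * Finite quotients that separate finitely many elements *)

Definition unit_group : Group.
Proof.
  refine (@Build_Group unit (fun _ _ => tt) (fun _ => tt) tt _ _ _ _ _);
    repeat intros []; reflexivity.
Defined.

Definition prod_group (G1 G2 : Group) : Group.
Proof.
  refine (@Build_Group (G1 * G2)%type
    (fun a b => (gmul (fst a) (fst b), gmul (snd a) (snd b)))
    (fun a => (ginv (fst a), ginv (snd a))) (gone, gone) _ _ _ _ _).
  - intros; simpl; now rewrite !gmul_assoc.
  - intros []; simpl; now rewrite !gmul_1l.
  - intros []; simpl; now rewrite !gmul_1r.
  - intros []; simpl; now rewrite !gmul_Vl.
  - intros []; simpl; now rewrite !gmul_Vr.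
Defined.

(** Take the direct product of one separating finite quotient per nontrivial element of [l],
    starting from the trivial group. *)
Lemma residually_finite_list {G : Group} (l : list G) :
  residually_finite G ->
  exists (F : Group) (f : G -> F), finite_group F /\ is_hom f /\
    forall g, In g l -> g <> gone -> f g <> gone.
Proof.
  intros rf. induction l as [|x l (F & f & [lF fin] & hom & sep)].
  - exists unit_group, (fun _ => tt). split; [|split].
    + exists (tt :: nil). intros []; now left.
    + now intros x y.
    + now intros g [].
  - destruct (classic (x = gone)) as [->|nx].
    + exists F, f. split; [now exists lF|split; [exact hom|]].
      intros g [<-|i] ng; [easy|now apply sep].
    + destruct (rf x nx) as (F1 & f1 & [l1 fin1] & hom1 & sep1).
      exists (prod_group F1 F), (fun g => (f1 g, f g)). split; [|split].
      * exists (list_prod l1 lF). intros [a b]; apply in_prod; auto.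
      * intros a b. simpl. now rewrite hom, hom1.
      * intros g [<-|i] ng e; injection e; intros e2 e1; [easy|].
        now apply (sep g).
Qed.

(** It suffices to keep the finitely many quotients $x^{-1}y$ with $x,y$ in [l] away from the
    identity. *)
Lemma residually_finite_inj {G : Group} (l : list G) :
  residually_finite G ->
  exists (F : Group) (f : G -> F), finite_group F /\ is_hom f /\
    forall x y, In x l -> In y l -> f x = f y -> x = y.
Proof.
  intros rf.
  destruct (residually_finite_list
    (flat_map (fun x => map (gmul (ginv x)) l) l) rf) as (F & f & fin & hom & sep).
  exists F, f. split; [exact fin|split; [exact hom|]]. intros x y ix iy e.
  apply NNPP; intros n. apply (sep (gmul (ginv x) y)).
  - apply in_flat_map. exists x. split; [exact ix|now apply in_map].
  - intros e1. apply n, (gmul_cancel_l _ (ginv x)). now rewrite gmul_Vl.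
  - now rewrite hom, <- e, <- hom, gmul_Vl, hom_one.
Qed.

(** * Finite function spaces and the index set of radii *)

(** Functions are enumerated up to agreement on a finite list, by induction on that list; agreement
    on an exhaustive list is equality by extensionality. *)
Lemma finite_fun {X Y : Type} (y0 : Y) {lX : list X} {lY : list Y} :
  (forall x, In x lX) -> (forall y, In y lY) ->
  exists l : list (X -> Y), forall f, In f l.
Proof.
  intros fX fY.
  assert (agree : forall m : list X, exists l : list (X -> Y), forall f,
    exists f', In f' l /\ forall x, In x m -> f' x = f x).
  { induction m as [|x0 m [l hl]].
    - exists ((fun _ => y0) :: nil). intros f. exists (fun _ => y0).
      split; [now left|now intros x []].
    - exists (flat_map (fun y => map (fun f x =>
        if excluded_middle_informative (x = x0) then y else f x) l) lY).
      intros f. destruct (hl f) as (f' & i & e).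
      exists (fun x => if excluded_middle_informative (x = x0) then f x0 else f' x).
      split.
      + apply in_flat_map. exists (f x0). split; [apply fY|].
        now apply (in_map (fun f1 x => if excluded_middle_informative (x = x0)
          then f x0 else f1 x)) in i.
      + intros x ix. destruct (excluded_middle_informative (x = x0)) as [->|n];
          [reflexivity|].
        apply e. destruct ix; congruence. }
  destruct (agree lX) as [l hl]. exists l. intros f.
  destruct (hl f) as (f' & i & e).
  replace f with f'; [exact i|]. apply functional_extensionality; auto.
Qed.

(** The radii $t<N$ serve as Hamming coordinates: exhaustiveness makes the distance separate points,
    and the absence of repetitions makes a single bad radius count only once. *)
Lemma finite_index (N : nat) :
  exists l : list {i : nat | (i < N)%nat},
    (forall i, In i l) /\ NoDup l /\ length l = N.
Proof.
  assert (lift : forall L : list nat, (forall i, In i L -> (i < N)%nat) ->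
    exists l : list {i : nat | (i < N)%nat}, map (@proj1_sig _ _) l = L).
  { induction L as [|i L IH]; intros hL; [now exists nil|].
    destruct IH as [l el]; [intros j ij; apply hL; now right|].
    exists (exist _ i (hL i (or_introl eq_refl)) :: l). simpl. now rewrite el. }
  destruct (lift (seq 0 N)) as [l el].
  { intros i ii. apply in_seq in ii. lia. }
  exists l. split; [|split].
  - intros [i hi].
    assert (ii : In i (map (@proj1_sig _ _) l)) by (rewrite el; apply in_seq; lia).
    apply in_map_iff in ii. destruct ii as ([j hj] & e & ij). simpl in e. subst j.
    now replace hi with hj by apply proof_irrelevance.
  - apply (NoDup_map_inv (@proj1_sig _ _)). rewrite el. apply seq_NoDup.
  - now rewrite <- (length_map (@proj1_sig _ _)), el, length_seq.
Qed.

(** * Hamming distance, as an integer count *)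

Definition mismatch {X : Type} (x y : X) : nat :=
  if excluded_middle_informative (x = y) then 0 else 1.

Definition hamming {T X : Type} (l : list T) (f g : T -> X) : nat :=
  list_sum (map (fun t => mismatch (f t) (g t)) l).

Lemma hamming_cons {T X : Type} (t : T) (l : list T) (f g : T -> X) :
  hamming (t :: l) f g = (mismatch (f t) (g t) + hamming l f g)%nat.
Proof. reflexivity. Qed.

Lemma hamming_eq0 {T X : Type} (l : list T) (f g : T -> X) :
  hamming l f g = 0%nat <-> (forall t, In t l -> f t = g t).
Proof.
  induction l as [|t l IH]; [split; [now intros _ t []|reflexivity]|].
  rewrite hamming_cons. unfold mismatch.
  destruct (excluded_middle_informative (f t = g t)) as [e|n]; split.
  - intros h x [<-|i]; [exact e|apply IH; auto].
  - intros h. apply IH. intros x i. apply h. now right.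
  - lia.
  - intros h. destruct n. apply h. now left.
Qed.

Lemma hamming_sym {T X : Type} (l : list T) (f g : T -> X) :
  hamming l f g = hamming l g f.
Proof.
  induction l as [|t l IH]; [reflexivity|]. rewrite !hamming_cons, IH. f_equal.
  unfold mismatch. do 2 destruct excluded_middle_informative; congruence.
Qed.

Lemma hamming_triangle {T X : Type} (l : list T) (f g h : T -> X) :
  (hamming l f h <= hamming l f g + hamming l g h)%nat.
Proof.
  induction l as [|t l IH]; [reflexivity|]. rewrite !hamming_cons.
  assert (mismatch (f t) (h t) <= mismatch (f t) (g t) + mismatch (g t) (h t))%nat.
  { unfold mismatch. do 3 destruct excluded_middle_informative; try lia; congruence. }
  lia.
Qed.

Lemma hamming_le_length {T X : Type} (l : list T) (f g : T -> X) :
  (hamming l f g <= length l)%nat.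
Proof.
  induction l as [|t l IH]; [reflexivity|]. rewrite hamming_cons. simpl.
  unfold mismatch. destruct excluded_middle_informative; lia.
Qed.

Lemma hamming_everywhere {T X : Type} (l : list T) (f g : T -> X) :
  (forall t, f t <> g t) -> hamming l f g = length l.
Proof.
  intros n. induction l as [|t l IH]; [reflexivity|]. rewrite hamming_cons, IH.
  unfold mismatch. now destruct excluded_middle_informative; [destruct (n t)|].
Qed.

Lemma hamming_le1 {T X : Type} (l : list T) (f g : T -> X) :
  NoDup l -> (forall t u, f t <> g t -> f u <> g u -> t = u) ->
  (hamming l f g <= 1)%nat.
Proof.
  intros nd uni. induction nd as [|t l nt nd IH]; [auto|]. rewrite hamming_cons.
  unfold mismatch. destruct excluded_middle_informative as [e|n]; [exact IH|].
  enough (hamming l f g = 0%nat) by lia.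
  apply hamming_eq0. intros u iu. apply NNPP. intros nu. apply nt.
  now rewrite (uni t u n nu).
Qed.

Lemma hamming_translate {T : Type} {A : Group} (l : list T) (f g z : T -> A) :
  hamming l (fun t => gmul (f t) (z t)) (fun t => gmul (g t) (z t)) = hamming l f g /\
  hamming l (fun t => gmul (z t) (f t)) (fun t => gmul (z t) (g t)) = hamming l f g.
Proof.
  induction l as [|t l [IH1 IH2]]; [easy|]. rewrite !hamming_cons, IH1, IH2.
  unfold mismatch. split; f_equal;
    do 2 destruct excluded_middle_informative; try congruence.
  - now apply gmul_cancel_r in e.
  - now apply gmul_cancel_l in e.
Qed.


(** * The finite wreath product and its bi-invariant metric *)

(** [V] acts by right translation of the argument and [T] is an inert coordinate. The first
    component of the product has the shape of the cocycle identity, so an untruncated cocycle paired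
    with its quotient map would give a homomorphism. *)
Definition wreath (A V : Group) (T : Type) : Group.
Proof.
  refine (@Build_Group ((V -> T -> A) * V)%type
    (fun a b => (fun x t => gmul (fst a x t) (fst b (gmul x (snd a)) t),
                 gmul (snd a) (snd b)))
    (fun a => (fun x t => ginv (fst a (gmul x (ginv (snd a))) t), ginv (snd a)))
    (fun _ _ => gone, gone) _ _ _ _ _).
  - intros [a u] [b v] [c w]; simpl. f_equal; [|apply gmul_assoc].
    do 2 (apply functional_extensionality; intro). now rewrite !gmul_assoc.
  - intros [a u]; simpl. f_equal; [|apply gmul_1l].
    do 2 (apply functional_extensionality; intro). now rewrite gmul_1l, gmul_1r.
  - intros [a u]; simpl. f_equal; [|apply gmul_1r].
    do 2 (apply functional_extensionality; intro). now rewrite gmul_1r.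
  - intros [a u]; simpl. f_equal; [|apply gmul_Vl].
    do 2 (apply functional_extensionality; intro). now rewrite gmul_Vl.
  - intros [a u]; simpl. f_equal; [|apply gmul_Vr].
    do 2 (apply functional_extensionality; intro). now rewrite gmulK, gmul_Vr.
Defined.

Lemma wreath_finite {A V : Group} (T : Type) {lT : list T} :
  finite_group A -> finite_group V -> (forall t, In t lT) ->
  finite_group (wreath A V T).
Proof.
  intros [lA fA] [lV fV] fT.
  destruct (finite_fun gone fT fA) as [lTA fTA].
  destruct (finite_fun (fun _ => gone) fV fTA) as [lVTA fVTA].
  exists (list_prod lVTA lV). intros [a u]. apply in_prod; auto.
Qed.

Definition max_hamming {X T Y : Type} (lX : list X) (lT : list T) (f g : X -> T -> Y) :=
  list_max (map (fun x => hamming lT (f x) (g x)) lX).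

Lemma max_hamming_le {X T Y : Type} {lX : list X} (lT : list T) (f g : X -> T -> Y) n :
  (forall x, In x lX) ->
  (max_hamming lX lT f g <= n)%nat <-> (forall x, hamming lT (f x) (g x) <= n)%nat.
Proof.
  intros fX. unfold max_hamming. rewrite list_max_le, Forall_map, Forall_forall. firstorder.
Qed.

Lemma hamming_le_max {X T Y : Type} {lX : list X} (lT : list T) (f g : X -> T -> Y) x :
  In x lX -> (hamming lT (f x) (g x) <= max_hamming lX lT f g)%nat.
Proof.
  intros ix. unfold max_hamming.
  pose proof (proj1 (list_max_le (map (fun x => hamming lT (f x) (g x)) lX) _) (le_n _))
    as le.
  rewrite Forall_map, Forall_forall in le. exact (le x ix).
Qed.

(** The value [length lT] for distinct [V]-parts is the largest possible Hamming count, which is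
    what the triangle inequality requires. *)
Definition wreath_ndist {A V : Group} {T : Type} (lV : list V) (lT : list T)
    (a b : wreath A V T) : nat :=
  if excluded_middle_informative (snd a = snd b)
  then max_hamming lV lT (fst a) (fst b) else length lT.

Definition wreath_dist {A V : Group} {T : Type} (lV : list V) (lT : list T)
    (a b : wreath A V T) : R :=
  INR (wreath_ndist lV lT a b) / INR (length lT).

(** When the [V]-parts agree, right multiplication translates the [A]-values at each vertex; left
    multiplication also permutes the vertices by $x\mapsto xw$, which leaves the maximum
    unchanged. *)
Lemma wreath_ndist_translate {A V : Group} {T : Type} {lV : list V} (lT : list T)
    (x y z : wreath A V T) : (forall v, In v lV) ->
  wreath_ndist lV lT (gmul x z) (gmul y z) = wreath_ndist lV lT x y /\
  wreath_ndist lV lT (gmul z x) (gmul z y) = wreath_ndist lV lT x y.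
Proof.
  intros fV. destruct x as [a u], y as [b v], z as [c w].
  unfold wreath_ndist; simpl. split.
  - destruct (excluded_middle_informative (u = v)) as [->|n];
      destruct excluded_middle_informative as [e|n1]; try congruence;
      [|now apply gmul_cancel_r in e].
    unfold max_hamming. f_equal. apply map_ext. intros x. apply hamming_translate.
  - destruct (excluded_middle_informative (u = v)) as [->|n];
      destruct excluded_middle_informative as [e|n1]; try congruence;
      [|now apply gmul_cancel_l in e].
    apply Nat.le_antisymm; apply max_hamming_le; auto; intros x.
    + rewrite (proj2 (hamming_translate lT _ _ (c x))).
      apply hamming_le_max, fV.
    (* The vertex $xw^{-1}$ is the one that the permutation sends to $x$. *)
    + assert (le := hamming_le_max lT
        (fun x t => gmul (c x t) (a (gmul x w) t))
        (fun x t => gmul (c x t) (b (gmul x w) t)) _ (fV (gmul x (ginv w)))).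
      simpl in le. rewrite (proj2 (hamming_translate lT _ _ _)) in le.
      now rewrite gmulVK in le.
Qed.

Lemma wreath_dist_biinv {A V : Group} {T : Type} (lV : list V) (lT : list T) :
  (forall v, In v lV) -> (forall t, In t lT) -> (0 < length lT)%nat ->
  biinv_metric_diam1 (@wreath_dist A V T lV lT).
Proof.
  intros fV fT pos.
  assert (posR : 0 < INR (length lT)) by now apply lt_0_INR.
  assert (posV : 0 < / INR (length lT)) by now apply Rinv_0_lt_compat.
  assert (le : forall a b : wreath A V T, (wreath_ndist lV lT a b <= length lT)%nat).
  { intros a b. unfold wreath_ndist. destruct excluded_middle_informative; [|auto].
    apply max_hamming_le; [auto|]. intros; apply hamming_le_length. }
  unfold wreath_dist, Rdiv. split; [|split; [|split; [|split; [|split]]]].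
  - intros a b. apply Rmult_le_pos; [apply pos_INR|lra].
  - intros [a u] [b v]. split.
    + intros e. apply Rmult_integral in e. destruct e as [e|e]; [|lra].
      apply INR_eq with (m := 0%nat) in e.
      unfold wreath_ndist in e; simpl in e.
      destruct excluded_middle_informative as [->|]; [|lia].
      f_equal. apply functional_extensionality; intros x.
      apply functional_extensionality; intros t.
      apply (hamming_eq0 lT); [|apply fT].
      pose proof (hamming_le_max lT a b x (fV x)). lia.
    + intros e. injection e as -> ->. replace (wreath_ndist _ _ _ _) with 0%nat;
        [simpl; ring|].
      symmetry. unfold wreath_ndist; simpl.
      destruct excluded_middle_informative; [|easy].
      apply Nat.le_0_r, max_hamming_le; [exact fV|]. intros x.
      apply Nat.le_0_r, hamming_eq0. auto.
  - intros [a u] [b v]. f_equal. f_equal. unfold wreath_ndist; simpl.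
    do 2 destruct excluded_middle_informative; try congruence.
    unfold max_hamming. f_equal. apply map_ext. intros x. apply hamming_sym.
  - intros a b c. rewrite <- Rmult_plus_distr_r, <- plus_INR.
    apply Rmult_le_compat_r; [lra|]. apply le_INR.
    (* If one of the two intermediate pairs has distinct [V]-parts, the right side already reaches
       the diameter [length lT]. *)
    pose proof (le a c) as h. unfold wreath_ndist in h |- *.
    destruct (excluded_middle_informative (snd a = snd b)) as [e1|],
      (excluded_middle_informative (snd b = snd c)) as [e2|]; try lia.
    destruct excluded_middle_informative as [|n]; [|congruence].
    apply max_hamming_le; [exact fV|]. intros x.
    etransitivity; [apply (hamming_triangle _ _ (fst b x))|].
    apply Nat.add_le_mono; apply hamming_le_max, fV.
  - intros x y z. now destruct (wreath_ndist_translate lT x y z fV) as [-> ->].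
  - intros a b. rewrite <- (Rinv_r (INR (length lT))) by lra.
    apply Rmult_le_compat_r; [lra|]. now apply le_INR.
Qed.

(** * Balls in a group and truncation to them *)

Fixpoint ball {G : Group} (E : list G) (n : nat) : list G :=
  match n with
  | O => gone :: nil
  | S n => ball E n ++ flat_map (fun x => map (gmul x) E) (ball E n)
  end.

Lemma ball_le {G : Group} (E : list G) {n m : nat} (x : G) :
  (n <= m)%nat -> In x (ball E n) -> In x (ball E m).
Proof. induction 1; [auto|]. intros i. simpl. apply in_or_app; auto. Qed.

Lemma ball_mul {G : Group} (E : list G) (n : nat) (x s : G) :
  In x (ball E n) -> In s E -> In (gmul x s) (ball E (S n)).
Proof.
  intros ix i. simpl. apply in_or_app. right. apply in_flat_map. exists x.
  split; [exact ix|now apply in_map].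
Qed.

(** The value depends on the chosen preimage of [v] unless [p] is injective on the ball. *)
Definition truncated {G V A : Group} (p : G -> V) (E : list G) (c : G -> A)
    (v : V) (n : nat) : A :=
  match excluded_middle_informative (exists x, In x (ball E n) /\ p x = v) with
  | left h => c (proj1_sig (constructive_indefinite_description _ h))
  | right _ => gone
  end.

Lemma truncated_in {G V A : Group} (p : G -> V) (E : list G) (c : G -> A) (n : nat) x :
  (forall x y, In x (ball E n) -> In y (ball E n) -> p x = p y -> x = y) ->
  In x (ball E n) -> truncated p E c (p x) n = c x.
Proof.
  intros inj ix. unfold truncated. destruct excluded_middle_informative as [h|h].
  - destruct constructive_indefinite_description as [y [iy e]]; simpl.
    now rewrite (inj y x).
  - destruct h. now exists x.
Qed.

Lemma truncated_out {G V A : Group} (p : G -> V) (E : list G) (c : G -> A) (n : nat) v :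
  ~ (exists x, In x (ball E n) /\ p x = v) -> truncated p E c v n = gone.
Proof.
  intros h. unfold truncated. now destruct excluded_middle_informative.
Qed.

(** * Almost multiplicative maps from a cocycle with finite values *)

Lemma cocycle_approximation (K G A : Group) (pi : K -> G) (kappa : K -> G -> A)
    (Phi : list K) (N : nat) :
  is_hom pi -> finite_group A -> residually_finite G -> (0 < N)%nat ->
  (forall g h x, kappa (gmul g h) x = gmul (kappa g x) (kappa h (gmul x (pi g)))) ->
  exists (Q : Group) (d : Q -> Q -> R) (phi : K -> Q),
    finite_group Q /\ biinv_metric_diam1 d /\ phi gone = gone /\
    (forall g h, In g Phi ->
       d (phi (gmul g h)) (gmul (phi g) (phi h)) <= / INR N) /\
    (forall g, In g Phi -> pi g <> gone \/ kappa g gone <> gone -> d (phi g) gone = 1).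
Proof.
  intros hpi finA rfG posN coc.
  (* Inverses are included so that right multiplication by $\pi(g)$ can be undone at the cost of one
     unit of radius. *)
  set (E := map pi Phi ++ map (fun g => ginv (pi g)) Phi).
  (* Truncation radii are below [N] and points are moved by at most one generator, so every point
     compared below lies in this ball. *)
  destruct (residually_finite_inj (ball E (S N)) rfG)
    as (V & p & [lV fV] & homp & injp).
  assert (inj : forall n x y, (n <= S N)%nat ->
    In x (ball E n) -> In y (ball E n) -> p x = p y -> x = y).
  { intros n x y le ix iy. apply injp; eapply ball_le; eauto. }
  assert (S1 : forall g, In g Phi -> In (pi g) E).
  { intros g i. apply in_or_app. left. now apply in_map. }
  assert (S2 : forall g, In g Phi -> In (ginv (pi g)) E).
  { intros g i. apply in_or_app. right. now apply (in_map (fun g => ginv (pi g))). }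
  set (inb := fun n v => exists x, In x (ball E n) /\ p x = v).
  assert (stepR : forall n v g, In g Phi -> inb n v ->
    inb (S n) (gmul v (p (pi g)))).
  { intros n v g i (x & ix & <-). exists (gmul x (pi g)).
    split; [now apply ball_mul; auto|apply homp]. }
  assert (stepL : forall n v g, In g Phi -> inb n (gmul v (p (pi g))) ->
    inb (S n) v).
  { intros n v g i (x & ix & e). exists (gmul x (ginv (pi g))).
    split; [now apply ball_mul; auto|]. rewrite homp, e, hom_inv by exact homp.
    apply gmulK. }
  assert (mono : forall n m v, (n <= m)%nat -> inb n v -> inb m v).
  { intros n m v le (x & ix & e). exists x. split; [now apply (ball_le _ _ le)|exact e]. }
  destruct (finite_index N) as (lT & fT & ndT & lenT).
  set (phi := fun g => ((fun v t => truncated p E (kappa g) v (proj1_sig t)), p (pi g))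
    : wreath A V {i : nat | (i < N)%nat}).
  (* The cocycle identity at $g=h=1$ makes this value idempotent. Both branches of [truncated] are
     then trivial for [kappa gone], so [phi] fixes the identity exactly. *)
  assert (k1 : forall x, kappa gone x = gone).
  { intros x. apply (gmul_cancel_l _ (kappa gone x)).
    pose proof (coc gone gone x) as e.
    now rewrite gmul_1l, (hom_one hpi), gmul_1r in e; rewrite <- e, gmul_1r. }
  assert (RN : 0 < INR N) by now apply lt_0_INR.
  exists (wreath A V {i : nat | (i < N)%nat}), (wreath_dist lV lT), phi.
  split; [|split; [|split; [|split]]].
  - apply (wreath_finite _ (lT := lT)); [exact finA|now exists lV|exact fT].
  - apply wreath_dist_biinv; [exact fV|exact fT|lia].
  - unfold phi; simpl. f_equal; [|now rewrite !hom_one].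
    do 2 (apply functional_extensionality; intro). unfold truncated.
    now destruct excluded_middle_informative.
  - intros g h ig. unfold wreath_dist. rewrite lenT.
    apply (Rmult_le_reg_r (INR N)); [exact RN|]. rewrite Rinv_l by lra.
    unfold Rdiv. rewrite Rmult_assoc, Rinv_l, Rmult_1_r by lra.
    apply (le_INR _ 1). unfold wreath_ndist.
    destruct excluded_middle_informative as [_|n];
      [|destruct n; simpl; now rewrite hpi, homp].
    apply max_hamming_le; [exact fV|]. intros v.
    assert (key : forall t : {i : nat | (i < N)%nat},
      (inb (proj1_sig t) v <-> inb (proj1_sig t) (gmul v (p (pi g)))) ->
      fst (phi (gmul g h)) v t = fst (gmul (phi g) (phi h)) v t).
    { intros [t lt] iff; simpl in iff |- *.
      destruct (classic (inb t v)) as [iv|niv].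
      - destruct (proj1 iff iv) as (y & iy & ey). destruct iv as (x & ix & <-).
        rewrite <- ey, !truncated_in; auto; try (intros ? ?; apply inj; lia).
        (* The preimage $y$ chosen for the moved vertex must be $x\pi(g)$, since [p] is injective on
           a ball containing both; this is the argument that the cocycle identity demands. *)
        rewrite coc. do 2 f_equal. apply injp.
        + apply (ball_le _ _ (n := S t)); [lia|]. apply ball_mul; auto.
        + apply (ball_le _ _ (n := t)); [lia|auto].
        + now rewrite homp.
      - rewrite !truncated_out by tauto; now rewrite gmul_1l. }
    apply hamming_le1; [exact ndT|]. intros t u nt nu.
    (* At a bad radius $t$ one of the two vertices is in the image of the ball, so both are at
       radius $t+1$ and at every larger one; hence no larger radius is bad. *)
    assert (bad : forall t u : {i : nat | (i < N)%nat},
      fst (phi (gmul g h)) v t <> fst (gmul (phi g) (phi h)) v t ->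
      fst (phi (gmul g h)) v u <> fst (gmul (phi g) (phi h)) v u ->
      ~ (proj1_sig t < proj1_sig u)%nat).
    { clear t u nt nu. intros t u nt nu lt. apply nu, key.
      assert (inb (proj1_sig u) v /\ inb (proj1_sig u) (gmul v (p (pi g)))); [|tauto].
      assert (ct : inb (proj1_sig t) v \/ inb (proj1_sig t) (gmul v (p (pi g)))).
      { apply NNPP. intros nn. apply nt, key. tauto. }
      destruct ct as [c|c]; split;
        first [now apply (mono (proj1_sig t)); [lia|]
              |apply (mono (S (proj1_sig t))); [lia|]; eauto]. }
    pose proof (bad t u nt nu) as ntu. pose proof (bad u t nu nt) as nut.
    destruct t as [t ht], u as [u hu]; simpl in ntu, nut.
    assert (t = u) by lia. subst u. f_equal. apply proof_irrelevance.
  - intros g ig [ng|ng].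
    (* Injectivity of [p] on the ball of radius 1 keeps the [V]-part nontrivial, so the distance is
       1 by definition. *)
    + unfold wreath_dist, wreath_ndist. simpl.
      destruct excluded_middle_informative as [e|_]; [|rewrite lenT; field; lra].
      destruct ng. apply injp.
      * rewrite <- (gmul_1l _ (pi g)). apply (ball_le _ _ (n := 1)); [lia|].
        apply ball_mul; [now left|auto].
      * apply (ball_le _ _ (n := 0)); [lia|now left].
      * now rewrite e, hom_one.
    + unfold wreath_dist.
      enough (e : wreath_ndist lV lT (phi g) gone = N)
        by (rewrite e, lenT; field; lra).
      unfold wreath_ndist.
      destruct excluded_middle_informative as [e|_]; [|exact lenT].
      apply Nat.le_antisymm.
      * apply max_hamming_le; [exact fV|]. intros v. rewrite <- lenT.
        apply hamming_le_length.
      (* The vertex $1=p(1)$ comes from the ball of radius 0, so no truncation erases the nontrivial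
         value there: all [N] coordinates differ. *)
      * rewrite <- lenT at 1.
        rewrite <- (hamming_everywhere lT (fst (phi g) gone)
          (fst (gone : wreath A V {i : nat | (i < N)%nat}) gone)).
        -- apply hamming_le_max, fV.
        -- intros [t lt]. simpl. rewrite <- (hom_one homp).
           rewrite truncated_in; [exact ng| |].
           ++ intros ? ?; apply inj; lia.
           ++ apply (ball_le _ _ (n := 0)); [lia|now left].
Qed.

(** * The cocycle of a group extension *)

(** For a section $s$ put $\kappa(g)(x)=s(x)\,g\,s(x\pi(g))^{-1}$; the inner factors of $s$ cancel
    in the cocycle identity. When $\pi(g)=1$, the value at $x=1$ is a conjugate of $g$, which gives
    the second clause without normalising $s(1)$. *)
Lemma kaloujnine_krasner {K : Group} {H : K -> Prop} (hH : normal_subgroup H)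
    {G : Group} {pi : K -> G} :
  is_quotient_map H pi ->
  exists kappa : K -> G -> subgroup_group hH,
    (forall g h x, kappa (gmul g h) x = gmul (kappa g x) (kappa h (gmul x (pi g)))) /\
    (forall g, pi g = gone -> kappa g gone = gone -> g = gone).
Proof.
  intros (hom & sur & ker).
  set (s := fun x => proj1_sig (constructive_indefinite_description _ (sur x))).
  assert (es : forall x, pi (s x) = x).
  { intros x. exact (proj2_sig (constructive_indefinite_description _ (sur x))). }
  assert (inH : forall g x, H (gmul (gmul (s x) g) (ginv (s (gmul x (pi g)))))).
  { intros g x. apply ker. rewrite !hom, hom_inv, !es by exact hom. apply gmul_Vr. }
  exists (fun g x => exist _ _ (inH g x)). split.
  - intros g h x. apply sub_eq; simpl.
    now rewrite hom, !gmul_assoc, gmulVK.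
  - intros g eg e. apply (f_equal (@proj1_sig _ _)) in e. simpl in e.
    rewrite eg, gmul_1l in e.
    apply (gmul_cancel_l _ (s gone)). apply (gmul_cancel_r _ (ginv (s gone))).
    now rewrite e, gmul_1r, gmul_Vr.
Qed.

(** * Weak soficity of the extension *)

Theorem theorem1 (K : Group) (H : K -> Prop) (hH : normal_subgroup H)
  (G : Group) (pi : K -> G) :
  is_quotient_map H pi ->
  residually_finite (subgroup_group hH) ->
  residually_finite G ->
  weakly_sofic K.
Proof.
  intros quot rfH rfG.
  destruct (kaloujnine_krasner hH quot) as (kappa & coc & faithful).
  (* Any constant in $(0,1)$ would do: nontrivial elements of [Phi] end up at distance exactly 1
     from the identity. *)
  exists (/ 2). split; [lra|]. intros Phi eps peps.
  destruct (archimed_cor1 eps peps) as (N & ltN & posN).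
  (* Only the cocycle values at the vertex 1 have to survive in the finite quotient of $H$. *)
  destruct (residually_finite_list (map (fun g => kappa g gone) Phi) rfH)
    as (A & q & finA & homq & sep).
  destruct (@cocycle_approximation K G A pi (fun g x => q (kappa g x)) Phi N)
    as (Q & d & phi & finQ & md & phi1 & defect & far); auto.
  - apply quot.
  - intros g h x. now rewrite coc, homq.
  - exists Q, d, phi. repeat split; auto; try apply md.
    + intros g h ig _ _. specialize (defect g h ig). lra.
    + intros g ig ng. rewrite (far g ig); [lra|].
      destruct (classic (pi g = gone)) as [e|e]; [right|now left].
      apply sep; [now apply (in_map (fun g => kappa g gone))|auto].
Qed.
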